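(* Let $X$ be a complex Banach space, let $A$ be a complex function algebra on a regular Hausdorff topological space $\Omega$, and let $A(\Omega,X)\subseteq C_b(\Omega,X)$ be a vector-valued function algebra with base algebra $A$. Let $f\in A(\Omega,X)$ with $\|f\|=1$. If there exists $\omega_0\in\operatorname{SB}(A)'$ such that $\|f(\omega_0)\|=1$, then $f$ is a super $\Delta$-point of $A(\Omega,X)$.
   Context: $C_b(\Omega)$ (resp. $C_b(\Omega,X)$) is the space of bounded continuous functions from $\Omega$ to $\mathbb{C}$ (resp. to $X$) with the supremum norm. A function algebra on $\Omega$ is a closed subalgebra of $C_b(\Omega)$ that separates the points of $\Omega$. A vector-valued function algebra $A(\Omega,X)$ is a closed subspace of $C_b(\Omega,X)$ such that: (1) the base algebra $A:=\{x^*\circ f: f\in A(\Omega,X),\ x^*\in X^*\}$ is a function algebra on $\Omega$; (2) for every $f\in A$ and $x\in X$, the function $t\mapsto f(t)x$ belongs to $A(\Omega,X)$; (3) for every $f\in A$ and $g\in A(\Omega,X)$, the pointwise product $fg$ belongs to $A(\Omega,X)$. A point $\omega_0\in\Omega$ is a strong boundary point of $A$ if for every open set $U\subseteq\Omega$ containing $\omega_0$ there is $f\in A$ with $f(\omega_0)=1=\|f\|$ and $\sup_{\omega\in\Omega\setminus U}|f(\omega)|<1$; $\operatorname{SB}(A)$ is the set of strong boundary points of $A$, and $\operatorname{SB}(A)'$ is the set of cluster (accumulation) points of $\operatorname{SB}(A)$ in $\Omega$. For a Banach space $Z$ with closed unit ball $B_Z$, a norm-one element $z\in Z$ is a super $\Delta$-point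 if, for every relatively weakly open subset $W$ of $B_Z$ with $z\in W$ and every $\varepsilon>0$, there exists $y\in W$ with $\|z-y\|>2-\varepsilon$. *)

(* Defs.v *)
From HB Require Import structures.
From mathcomp Require Import all_boot all_order all_algebra.
From mathcomp Require Import complex.
From mathcomp Require Import boolp classical_sets functions reals topology.
From mathcomp Require Import normedtype.

Set Implicit Arguments.
Unset Strict Implicit.
Unset Printing Implicit Defensive.

Import Order.TTheory GRing.Theory Num.Theory.

Local Open Scope classical_set_scope.
Local Open Scope ring_scope.
Local Open Scope complex_scope.

Section NormedSubspace.
Variables (K : numFieldType) (V : normedModType K) (S : submodClosed V).

Record normed_subspace := NormedSubspace {
  normed_subspace_val :> V;
  normed_subspace_valP : normed_subspace_val \in S }.

HB.instance Definition _ := [isSub for normed_subspace_val].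
HB.instance Definition _ := [Choice of normed_subspace by <:].
HB.instance Definition _ := [SubChoice_isSubLmodule of normed_subspace by <:].

Let norm (f : normed_subspace) : K := `|val f|.

Let normD f g : norm (f + g) <= norm f + norm g.
Proof. by rewrite /norm raddfD ler_normD. Qed.

Let normZ (k : K) f : norm (k *: f) = `|k| * norm f.
Proof. by rewrite /norm linearZ normrZ. Qed.

Let norm_eq0 f : norm f = 0 -> f = 0.
Proof. by move/normr0_eq0 => f0; apply: val_inj; rewrite f0 raddf0. Qed.

HB.instance Definition _ :=
  @Lmodule_isNormed.Build K normed_subspace norm normD normZ norm_eq0.

Lemma normed_subspace_normE (f : normed_subspace) : `|f| = `|val f|.
Proof. by []. Qed.

End NormedSubspace.

Section SuperDelta.
Variables (K : numFieldType) (Z : normedModType K).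

Record topological_dual := TopologicalDual {
  topological_dual_fun :> {linear Z -> K^o};
  topological_dual_continuous : continuous topological_dual_fun }.

(* The coarsest topology making every bounded linear functional continuous. *)
Definition weak_top := sup_topology (fun phi : topological_dual =>
  Topological.on (initial_topology (phi : Z -> K^o))).

HB.instance Definition _ := Topological.on weak_top.

Definition closed_unit_ball : set Z := [set z | `|z| <= 1].

Definition relatively_weakly_open (W : set Z) :=
  exists2 U : set weak_top, open U & W = closed_unit_ball `&` U.

Definition super_delta_point (z : Z) :=
  `|z| = 1 /\
  forall W : set Z, relatively_weakly_open W -> W z ->
  forall e : K, 0 < e -> exists2 y, W y & 2 - e < `|z - y|.

End SuperDelta.

Section BoundedContinuous.
Variables (R : realType) (T : topologicalType) (V : normedModType R[i]).

Definition bcfun_pred : {pred T -> V} :=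
  mem [set f : T -> V | continuous f /\ bounded_fun f].

Record bcfun := BCFun {
  bcfun_val :> T -> V;
  bcfun_valP : bcfun_val \in bcfun_pred }.

Lemma bcfunP (f : T -> V) :
  (f \in bcfun_pred) <->
  continuous f /\ exists M : R, forall t, `|f t| <= M%:C.
Proof.
rewrite inE /=; split=> -[cf bf]; split=> //.
  case: bf => M [/complex_realP[m ->] mf].
  by exists (m + 1) => t; apply: (mf (m + 1)%:C) => //; rewrite ltcR ltrDl.
case: bf => m mf; exists m%:C; split; first by apply/complex_realP; exists m.
by move=> M /ltW mM t _; apply: le_trans mM.
Qed.

Fact bcfun_submod_closed : submod_closed bcfun_pred.
Proof.
split.
  apply/bcfunP; split; first exact: cst_continuous.
  by exists 0 => t; rewrite normr0.
move=> k f g /bcfunP[cf [M Mf]] /bcfunP[cg [N Ng]]; apply/bcfunP; split.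
  by move=> t; apply: cvgD; [apply: cvgZl_tmp; exact: cf|exact: cg].
exists (complex.Re `|k| * M + N) => t.
have kE : (complex.Re `|k|)%:C = `|k| by rewrite RRe_real ?normr_real.
rewrite rmorphD rmorphM /= kE.
by rewrite (le_trans (ler_normD _ _))// lerD// normrZ ler_wpM2l.
Qed.

HB.instance Definition _ :=
  GRing.isSubmodClosed.Build R[i] (T -> V) bcfun_pred bcfun_submod_closed.

HB.instance Definition _ := [isSub for bcfun_val].
HB.instance Definition _ := [Choice of bcfun by <:].
HB.instance Definition _ := [SubChoice_isSubLmodule of bcfun by <:].

(* Norms live in R[i], but are real: the supremum is taken in R. On the empty
   set it is 0 by the convention of [sup]. *)
Definition sup_norm_on (D : set T) (f : T -> V) : R :=
  sup [set complex.Re `|f t| | t in D].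

Let norm (f : bcfun) : R[i] := (sup_norm_on setT f)%:C.

Let has_sup_norm (f : bcfun) (t : T) :
  has_sup [set complex.Re `|f t| | t in setT].
Proof.
split; first by exists (complex.Re `|f t|), t.
have /bcfunP[_ [M Mf]] := bcfun_valP f.
by exists M => _ [s _ <-]; rewrite -lecR RRe_real ?normr_real.
Qed.

Let le_norm (f : bcfun) t : `|f t| <= norm f.
Proof.
rewrite -[leLHS]RRe_real ?normr_real// lecR.
by apply: sup_upper_bound; [exact: has_sup_norm t|exists t].
Qed.

Let norm_ge0 (f : bcfun) : 0 <= sup_norm_on setT f.
Proof.
rewrite /sup_norm_on.
have [->|/set0P[x Dx]] :=
  eqVneq [set complex.Re `|f t| | t in setT] (set0 : set R).
  by rewrite sup0.
case: (Dx) => t _ fx; rewrite -fx in Dx *.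
apply: (@le_trans _ _ (complex.Re `|f t|)).
  by rewrite -ler0c RRe_real ?normr_real.
exact: sup_upper_bound (has_sup_norm f t) _ Dx.
Qed.

Let norm_le (f : bcfun) (M : R) : 0 <= M -> (forall t, `|f t| <= M%:C) ->
  norm f <= M%:C.
Proof.
move=> M0 Mf; rewrite lecR /sup_norm_on.
have [->|/set0P ne] :=
  eqVneq [set complex.Re `|f t| | t in setT] (set0 : set R).
  by rewrite sup0.
apply: ge_sup => // _ [s _ <-].
by rewrite -lecR RRe_real ?normr_real.
Qed.

Let normD f g : norm (f + g) <= norm f + norm g.
Proof.
rewrite /norm -rmorphD; apply: norm_le => [|t]; first by rewrite addr_ge0.
rewrite rmorphD -[(f + g) t]/(f t + g t).
by rewrite (le_trans (ler_normD _ _))// lerD//; exact: le_norm.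
Qed.

Let normZ_le (k : R[i]) f : norm (k *: f) <= `|k| * norm f.
Proof.
have kE : (complex.Re `|k|)%:C = `|k| by rewrite RRe_real ?normr_real.
rewrite -{1}kE /norm -rmorphM; apply: norm_le => [|t].
  by rewrite mulr_ge0// -ler0c kE.
have -> : `|(k *: f) t| = `|k| * `|f t| by exact: normrZ.
rewrite rmorphM /= kE ler_wpM2l//.
Qed.

Let normZ (k : R[i]) f : norm (k *: f) = `|k| * norm f.
Proof.
apply/le_anti; rewrite normZ_le/=; have [->|k0] := eqVneq k 0.
  by rewrite normr0 mul0r ler0c.
rewrite -ler_pdivlMl ?normr_gt0// -normfV.
by rewrite -{1}[f](scalerK k0) normZ_le.
Qed.

Let norm_eq0 f : norm f = 0 -> f = 0.
Proof.
move=> f0; apply: val_inj; apply: funext => t /=; apply/eqP.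
rewrite -normr_le0 -f0; exact: le_norm.
Qed.

HB.instance Definition _ :=
  @Lmodule_isNormed.Build R[i] bcfun norm normD normZ norm_eq0.

Lemma bcfun_normE (f : bcfun) : `|f| = (sup_norm_on setT f)%:C.
Proof. by []. Qed.

End BoundedContinuous.

Section Multiplication.
Variables (R : realType) (T : topologicalType) (V : normedModType R[i]).

Fact bcfun_scale_subproof (f : bcfun T R[i]^o) (g : bcfun T V) :
  (fun t => (f t : R[i]) *: g t) \in @bcfun_pred R T V.
Proof.
have /bcfunP[cf [M Mf]] := bcfun_valP f.
have /bcfunP[cg [N Ng]] := bcfun_valP g.
apply/bcfunP; split; first by move=> t; apply: cvgZ; [exact: cf|exact: cg].
exists (M * N) => t.
by rewrite rmorphM /= normrZ ler_pM.
Qed.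

(* The pointwise product; for [V := R[i]^o] this is the product of C_b(T). *)
Definition bcfun_scale (f : bcfun T R[i]^o) (g : bcfun T V) : bcfun T V :=
  BCFun (bcfun_scale_subproof f g).

Fact bcfun_cst_subproof (x : V) : (fun=> x) \in @bcfun_pred R T V.
Proof.
apply/bcfunP; split; first exact: cst_continuous.
by exists (complex.Re `|x|) => t; rewrite RRe_real ?normr_real.
Qed.

Definition bcfun_cst (x : V) : bcfun T V := BCFun (bcfun_cst_subproof x).

End Multiplication.

Section FunctionAlgebra.
Variables (R : realType) (T : topologicalType).

Definition separates_points (A : set (bcfun T R[i]^o)) :=
  forall s t : T, s != t -> exists2 f, A f & f s != f t.

(* No unit: the constants need not belong to A. *)
Definition function_algebra (A : set (bcfun T R[i]^o)) :=
  [/\ submod_closed (mem A),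
      forall f g, A f -> A g -> A (bcfun_scale f g),
      closed A &
      separates_points A].

Definition strong_boundary (A : set (bcfun T R[i]^o)) : set T :=
  [set w0 | forall U : set T, open U -> U w0 ->
    exists f, [/\ A f, f w0 = 1, `|f| = 1 & sup_norm_on (~` U) f < 1]].

Variable X : normedModType R[i].

Definition base_algebra (AX : submodClosed (bcfun T X)) :
    set (bcfun T R[i]^o) :=
  [set g : bcfun T R[i]^o | exists (f : bcfun T X) (phi : topological_dual X),
    f \in AX /\ forall t, g t = phi (f t)].

Definition vector_valued_function_algebra (AX : submodClosed (bcfun T X)) :=
  [/\ closed [set f : bcfun T X | f \in AX],
      function_algebra (base_algebra AX),
      forall f (x : X),
        base_algebra AX f -> bcfun_scale f (bcfun_cst T x) \in AX &
      forall f g, base_algebra AX f -> g \in AX -> bcfun_scale f g \in AX].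

End FunctionAlgebra.

(* Main.v *)
Require Import Defs.
From mathcomp Require Import all_boot all_order all_algebra.
From mathcomp Require Import complex ring lra.
From mathcomp Require Import boolp classical_sets functions reals topology.
From mathcomp Require Import normedtype sequences.

Set Implicit Arguments.
Unset Strict Implicit.
Unset Printing Implicit Defensive.

Import Order.TTheory GRing.Theory Num.Theory.
Import numFieldNormedType.Exports.

Local Open Scope classical_set_scope.
Local Open Scope ring_scope.
Local Open Scope complex_scope.

(**
Given f of norm one and finitely many functionals, the goal is a g in the unit
ball at which these functionals nearly agree with f and which is at distance
almost 2 from f.  The candidate is a reflection of f near one point,
g = (1 - tau) (f - 2 h f) with h in the base algebra A and h(w) = 1, so that
(f - g)(w) = (2 - tau) f(w); here w is a strong boundary point at which the
norm of f is almost 1.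

Two things have to be arranged.

The norm of g must not exceed 1, which asks for |1 - 2 h| <= 1 + tau although h
is complex valued: h must take its values near the segment [0, 1].  If k in A
peaks at w, so does z p(z) evaluated at a power of k, for any polynomial p with
p(1) = 1; multiplying p by z makes up for the possible absence of constants in
A.  Now the mean q of z, ..., z^M is close to 1 when M |1 - z| is small and
close to 0 when M |1 - z| is large.  Averaging over M = 1, 2, 4, ..., 2^(L-1),
only boundedly many terms, up to a geometrically decaying error, are close to
neither 0 nor 1, so |1 - 2 h| <= 1 + 12 / L on the whole disc
([flat_poly_flat], [strong_boundary_flat_peak]).

The functionals must not notice the perturbation.  As w0 is an accumulation
point in a Hausdorff space, there are N strong boundary points close to w0 with
disjoint neighbourhoods ([limit_point_disjoint_nbhs]), hence functions h_1, ...,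
h_N, with h_i at most 1 / N off the i-th neighbourhood.  Every combination of
the h_i f with coefficients in the unit disc then has norm at most 2
([reflected_bumps]).  Choosing the coefficients to align the phases shows that a
bounded functional phi satisfies sum_i |phi (h_i f)| <= 2 ||phi||
([dual_seminorm_unconditional]), so for large N one of the h_i f is nearly
invisible to all the given functionals.
*)

(** * The norm as a real number *)

Section RealNorm.
Variable R : realType.

(** Norms of complex normed spaces live in the partially ordered field [R[i]];
    their real part gives access to case analysis and linear arithmetic. *)
Definition rnorm (V : normedZmodType R[i]) (v : V) : R := complex.Re `|v|.

Lemma rnormE (V : normedZmodType R[i]) (v : V) : (rnorm v)%:C = `|v|.
Proof. by rewrite /rnorm RRe_real ?normr_real. Qed.

Lemma rnorm_ge0 (V : normedZmodType R[i]) (v : V) : 0 <= rnorm v.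
Proof. by rewrite -lecR rnormE normr_ge0. Qed.

Lemma rnorm0 (V : normedZmodType R[i]) : rnorm (0 : V) = 0.
Proof. by rewrite /rnorm normr0. Qed.

Lemma rnormN (V : normedZmodType R[i]) (v : V) : rnorm (- v) = rnorm v.
Proof. by rewrite /rnorm normrN. Qed.

Lemma rnormB (V : normedZmodType R[i]) (v w : V) : rnorm (v - w) = rnorm (w - v).
Proof. by rewrite /rnorm distrC. Qed.

Lemma rnormD (V : normedZmodType R[i]) (v w : V) :
  rnorm (v + w) <= rnorm v + rnorm w.
Proof. by rewrite -lecR rmorphD/= !rnormE ler_normD. Qed.

Lemma rnorm_sum (V : normedZmodType R[i]) I (r : seq I) (F : I -> V) :
  rnorm (\sum_(i <- r) F i) <= \sum_(i <- r) rnorm (F i).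
Proof.
elim/big_ind2: _ => [|? ? ? ? h1 h2|//]; first by rewrite rnorm0.
by rewrite (le_trans (rnormD _ _))// lerD.
Qed.

Lemma rnormZ (V : normedModType R[i]) (a : R[i]) (v : V) :
  rnorm (a *: v) = rnorm a * rnorm v.
Proof. by apply: complexI; rewrite rmorphM/= !rnormE normrZ. Qed.

Lemma rnormM (a b : R[i]) : rnorm (a * b) = rnorm a * rnorm b.
Proof. by apply: complexI; rewrite rmorphM/= !rnormE normrM. Qed.

Lemma rnormX (a : R[i]) n : rnorm (a ^+ n) = rnorm a ^+ n.
Proof. by apply: complexI; rewrite rmorphXn/= !rnormE normrX. Qed.

Lemma rnormC (a : R) : rnorm a%:C = `|a|.
Proof.
apply: complexI.
by rewrite rnormE normc_def/= expr0n/= addr0 sqrtr_sqr.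
Qed.

Lemma rnorm1 : rnorm (1 : R[i]) = 1.
Proof. by rewrite /rnorm normr1. Qed.

Lemma rnorm_nat n : rnorm (n%:R : R[i]) = n%:R.
Proof. by apply: complexI; rewrite rnormE normr_nat rmorph_nat. Qed.

Lemma rnormV (a : R[i]) : rnorm a^-1 = (rnorm a)^-1.
Proof. by apply: complexI; rewrite fmorphV/= !rnormE normfV. Qed.

Lemma rnorm_reflection (w : R[i]) : rnorm (1 - 2 * w) <= 1 + 2 * rnorm w.
Proof.
by apply: le_trans (rnormD _ _) _; rewrite rnormN rnorm1 rnormM rnorm_nat.
Qed.

Lemma rnorm_reflection_compl (w : R[i]) :
  rnorm (1 - 2 * w) <= 1 + 2 * rnorm (1 - w).
Proof.
by rewrite -rnormN (_ : - _ = 1 - 2 * (1 - w)) ?rnorm_reflection//; ring.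
Qed.

End RealNorm.

(** * A polynomial mapping the unit disc close to the segment [0, 1] *)

Section Polynomial.

(** The terms grow at most geometrically until [2 ^+ j * x] reaches 1, and decay
    geometrically afterwards. *)
Lemma sum_min_geometric (R : realFieldType) (x : R) (t : nat -> R) n :
  0 <= x -> (forall j, t j <= 2 ^+ j * x) ->
  (forall j, t j * (2 ^+ j * x) <= 2) -> \sum_(j < n) t j <= 6.
Proof.
move=> x0 t1 t2.
have y0 j : 0 <= 2 ^+ j * x by rewrite mulr_ge0// exprn_ge0.
(* Up to the threshold the sum is controlled by the next bound 2^n x;
   beyond it, 4 / (2^n x) bounds what can still be added below 6. *)
suff [[h1 h2]|[h1 h2]] :
    (2 ^+ n * x <= 1 /\ \sum_(j < n) t j <= 2 ^+ n * x) \/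
    (1 < 2 ^+ n * x /\ (6 - \sum_(j < n) t j) * (2 ^+ n * x) >= 4).
- lra.
- nra.
elim: n => [|n IH].
  rewrite big_ord0 expr0 mul1r.
  by have [?|?] := leP x 1; [left|right]; split=> //; lra.
rewrite big_ord_recr/= exprS -mulrA.
move: (t1 n) (t2 n) (y0 n) IH; set y := 2 ^+ n * x; set s := \sum_(_ < n) _.
move=> a b c [[d e]|[d e]].
  by have [?|?] := leP (2 * y) 1; [left|right]; split=> //; nra.
right; split; nra.
Qed.

Variable R : realType.
Implicit Types z : R[i].

(** Multiplied by [z], this is the mean of [z], ..., [z ^+ (2 ^ j)]. *)
Definition dyadic_mean j : {poly R[i]} :=
  ((2 ^ j)%:R^-1 : R[i]) *: \sum_(n < 2 ^ j) 'X^n.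

Lemma dyadic_meanE j z :
  (dyadic_mean j).[z] = (2 ^ j)%:R^-1 * \sum_(n < 2 ^ j) z ^+ n.
Proof.
rewrite hornerZ horner_sum; congr (_ * _).
by apply: eq_bigr => n _; rewrite hornerXn.
Qed.

Lemma pow2_neq0 j : (2 ^ j)%:R != 0 :> R[i].
Proof. by rewrite pnatr_eq0 expn_eq0. Qed.

Lemma pow2_gt0 j : 0 < (2 ^ j)%:R :> R.
Proof. by rewrite ltr0n expn_gt0. Qed.

Lemma dyadic_mean1 j : (dyadic_mean j).[1] = 1.
Proof.
rewrite dyadic_meanE (eq_bigr (fun=> 1)); last by move=> i _; rewrite expr1n.
by rewrite sumr_const card_ord mulVf ?pow2_neq0.
Qed.

Lemma rnorm_mean j (F : 'I_(2 ^ j) -> R[i]) (M : R) :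
  (forall n, rnorm (F n) <= M) ->
  rnorm ((2 ^ j)%:R^-1 * \sum_n F n) <= M.
Proof.
move=> FM; rewrite rnormM rnormV rnorm_nat mulrC ler_pdivrMr ?pow2_gt0//.
apply: le_trans (rnorm_sum _ _) _.
apply: le_trans (ler_sum _ (fun i _ => FM i)) _.
by rewrite sumr_const card_ord mulr_natr.
Qed.

Lemma dyadic_mean_le1 j z : rnorm z <= 1 -> rnorm (dyadic_mean j).[z] <= 1.
Proof.
move=> z1; rewrite dyadic_meanE; apply: rnorm_mean => n.
by rewrite rnormX exprn_ile1 ?rnorm_ge0.
Qed.

Lemma rnorm_subX1 z n : rnorm z <= 1 ->
  rnorm (1 - z ^+ n) <= n%:R * rnorm (1 - z).
Proof.
move=> z1; rewrite rnormB subrX1 rnormM rnormB mulrC ler_wpM2r ?rnorm_ge0//.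
apply: le_trans (rnorm_sum _ _) _.
apply: le_trans (_ : \sum_(i < n) 1 <= _); last by rewrite sumr_const card_ord.
by apply: ler_sum => i _; rewrite rnormX exprn_ile1 ?rnorm_ge0.
Qed.

(** Each of the [2 ^ j] powers of [z] is within [2 ^ j * |1 - z|] of 1. *)
Lemma dyadic_mean_near1 j z : rnorm z <= 1 ->
  rnorm (1 - z * (dyadic_mean j).[z]) <= 2 ^+ j * rnorm (1 - z).
Proof.
move=> z1.
have -> : 1 - z * (dyadic_mean j).[z] =
    (2 ^ j)%:R^-1 * \sum_(n < 2 ^ j) (1 - z ^+ n.+1).
  rewrite sumrB sumr_const card_ord mulrBr mulVf ?pow2_neq0//.
  rewrite dyadic_meanE mulrCA mulr_sumr; congr (_ - _ * _).
  by apply: eq_bigr => i _; rewrite exprS.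
apply: rnorm_mean => n; apply: le_trans (rnorm_subX1 _ z1) _.
by rewrite ler_wpM2r ?rnorm_ge0// -natrX ler_nat.
Qed.

(** Summing the geometric progression gives [z * (1 - z ^+ (2 ^ j))]. *)
Lemma dyadic_mean_far1 j z : rnorm z <= 1 ->
  rnorm (z * (dyadic_mean j).[z]) * (2 ^+ j * rnorm (1 - z)) <= 2.
Proof.
move=> z1.
have <- : rnorm (z * (1 - z ^+ (2 ^ j))) =
   rnorm (z * (dyadic_mean j).[z]) * (2 ^+ j * rnorm (1 - z)).
  rewrite -natrX -(rnorm_nat R) -!rnormM dyadic_meanE -opprB subrX1.
  rewrite -[in RHS]opprB; congr rnorm.
  field; exact: pow2_neq0.
rewrite rnormM.
have : rnorm (1 - z ^+ (2 ^ j)) <= 1 + 1.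
  apply: le_trans (rnormD _ _) _; rewrite rnormN rnorm1 rnormX lerD//.
  by rewrite exprn_ile1 ?rnorm_ge0.
have := rnorm_ge0 z; have := rnorm_ge0 (1 - z ^+ (2 ^ j)); nra.
Qed.

Definition flat_poly L : {poly R[i]} :=
  (L%:R^-1 : R[i]) *: \sum_(j < L) dyadic_mean j.

Lemma flat_polyE L z :
  (flat_poly L).[z] = L%:R^-1 * \sum_(j < L) (dyadic_mean j).[z].
Proof. by rewrite hornerZ horner_sum. Qed.

Lemma flat_poly1 L : (0 < L)%N -> (flat_poly L).[1] = 1.
Proof.
move=> L0; rewrite flat_polyE (eq_bigr (fun=> 1)).
  by rewrite sumr_const card_ord mulVf ?pnatr_eq0 -?lt0n.
by move=> i _; rewrite dyadic_mean1.
Qed.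

Lemma flat_poly_le1 L z : (0 < L)%N -> rnorm z <= 1 ->
  rnorm (flat_poly L).[z] <= 1.
Proof.
move=> L0 z1; rewrite flat_polyE rnormM rnormV rnorm_nat mulrC.
rewrite ler_pdivrMr ?ltr0n// mul1r; apply: le_trans (rnorm_sum _ _) _.
apply: le_trans (_ : \sum_(i < L) 1 <= _); last by rewrite sumr_const card_ord.
by apply: ler_sum => i _; exact: dyadic_mean_le1.
Qed.

(** By convexity it is enough to bound the mean of the excesses
    [|1 - 2 w_j| - 1], where [w_j] is the [j]-th mean of powers.  Such an excess
    is at most [2 |w_j|] and at most [2 |1 - w_j|], so the two bounds on [w_j]
    make the sum of all the excesses at most 12. *)
Lemma flat_poly_flat L z : (0 < L)%N -> rnorm z <= 1 ->
  rnorm (1 - 2 * (z * (flat_poly L).[z])) <= 1 + 12 / L%:R.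
Proof.
move=> L0 z1; have L0R : 0 < L%:R :> R by rewrite ltr0n.
pose w j := z * (dyadic_mean j).[z].
have -> : 1 - 2 * (z * (flat_poly L).[z]) = L%:R^-1 * \sum_(j < L) (1 - 2 * w j).
  have LC : L%:R != 0 :> R[i] by rewrite pnatr_eq0 -lt0n.
  rewrite sumrB sumr_const card_ord -mulr_sumr -mulr_sumr flat_polyE mulrBr.
  by rewrite mulVf//; congr (_ - _); field.
rewrite rnormM rnormV rnorm_nat mulrC ler_pdivrMr// mulrDl mul1r divfK ?gt_eqF//.
apply: le_trans (rnorm_sum _ _) _.
pose t j := (rnorm (1 - 2 * w j) - 1) / 2.
have -> : \sum_(j < L) rnorm (1 - 2 * w j) = L%:R + 2 * \sum_(j < L) t j.
  have -> : L%:R = \sum_(j < L) (1 : R) by rewrite sumr_const card_ord.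
  rewrite mulr_sumr -big_split/=.
  by apply: eq_bigr => j _; rewrite /t; field.
rewrite lerD2l.
suff : \sum_(j < L) t j <= 6 by lra.
have d0 := rnorm_ge0 (1 - z).
apply: (@sum_min_geometric _ (rnorm (1 - z))) => // j.
  apply: le_trans (dyadic_mean_near1 j z1); rewrite -/(w j) /t.
  by have := rnorm_reflection_compl (w j); lra.
apply: le_trans (dyadic_mean_far1 j z1); rewrite ler_wpM2r//.
  by rewrite mulr_ge0// exprn_ge0.
rewrite -/(w j) /t.
by have := rnorm_reflection (w j); lra.
Qed.

End Polynomial.

(** * Weak neighbourhoods and finite families of functionals *)

Section Duality.
Variables (R : realType) (Z : normedModType R[i]).
Implicit Types (phi : topological_dual Z) (s : seq (topological_dual Z)).

(** Summing over the family, instead of taking a maximum, lets a single averaging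
    argument deal with all its functionals at once. *)
Definition dual_seminorm s (y : Z) : R := \sum_(phi <- s) rnorm (phi y : R[i]).

(** The balls around [z] of the seminorms [dual_seminorm s] generate a filter;
    it converges to [z] in the initial topology of each functional, hence in
    their supremum. *)
Lemma weakly_open_seminorm (U : set (weak_top Z)) (z : Z) : open U -> U z ->
  exists s (d : R), 0 < d /\ forall y : Z, dual_seminorm s (y - z) < d -> U y.
Proof.
move=> oU Uz.
pose F : set_system (weak_top Z) := [set A | exists s (d : R), 0 < d /\
  forall y : Z, dual_seminorm s (y - z) < d -> A y].
have FF : Filter F.
  split.
  - by exists [::], 1; split.
  - move=> A B [s [d [d0 sA]]] [s' [d' [d'0 sB]]].
    exists (s ++ s'), (Num.min d d'); split; first by rewrite lt_min d0.
    move=> y; rewrite /dual_seminorm big_cat/= lt_min => /andP[yd yd'].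
    have ge0 (r : seq (topological_dual Z)) :
        0 <= \sum_(phi <- r) rnorm (phi (y - z) : R[i]).
      by apply: sumr_ge0 => *; exact: rnorm_ge0.
    split; [apply: sA; apply: le_lt_trans yd|apply: sB; apply: le_lt_trans yd'].
      by rewrite lerDl ge0.
    by rewrite lerDr ge0.
  - by move=> A B AB [s [d [d0 sA]]]; exists s, d; split=> // y /sA; exact: AB.
suff : F --> (z : weak_top Z) by apply; apply: open_nbhs_nbhs.
apply/cvg_sup => phi A; move=> /= [_ [[B oB <-] Bz BA]].
have /nbhs_ballP[e /= e0 eB] : nbhs (phi z) B by apply: open_nbhs_nbhs.
have eE : (complex.Re e)%:C = e by rewrite RRe_real// gtr0_real.
exists [:: phi], (complex.Re e); split; first by rewrite -ltcR eE.
move=> y; rewrite /dual_seminorm big_seq1 => yz.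
apply: BA; apply: eB; rewrite -ball_normE /= distrC -linearB -rnormE -eE.
by rewrite ltcR.
Qed.

Lemma dual_bounded phi :
  exists2 C : R, 0 <= C & forall y, rnorm (phi y : R[i]) <= C * rnorm y.
Proof.
have /linear_bounded_continuous/linear_boundedP/pinfty_ex_gt0[r r0 rphi] :=
  @topological_dual_continuous _ _ phi.
have rE : (complex.Re r)%:C = r by rewrite RRe_real// gtr0_real.
exists (complex.Re r); first by rewrite -ler0c rE ltW.
by move=> y; rewrite -lecR rmorphM/= rE !rnormE.
Qed.

Lemma dual_seminormD s y y' :
  dual_seminorm s (y + y') <= dual_seminorm s y + dual_seminorm s y'.
Proof.
rewrite /dual_seminorm -big_split; apply: ler_sum => phi _.
by rewrite linearD rnormD.
Qed.

Lemma dual_seminormZ s (a : R[i]) y :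
  dual_seminorm s (a *: y) = rnorm a * dual_seminorm s y.
Proof.
rewrite /dual_seminorm mulr_sumr; apply: eq_bigr => phi _.
by rewrite linearZ -rnormM.
Qed.

Lemma dual_seminorm_ge0 s y : 0 <= dual_seminorm s y.
Proof. by apply: sumr_ge0 => *; exact: rnorm_ge0. Qed.

(** For a single functional [phi], take for [a i] the phase that turns
    [phi (v i)] into its modulus: the sum of the moduli is then the value of
    [phi] at one combination of the [v i], all of which are bounded by [B]. *)
Lemma dual_seminorm_unconditional s : exists2 C : R, 0 <= C &
  forall N (v : 'I_N -> Z) (B : R),
    (forall a : 'I_N -> R[i], (forall i, rnorm (a i) <= 1) ->
      rnorm (\sum_i a i *: v i) <= B) ->
    \sum_i dual_seminorm s (v i) <= C * B.
Proof.
elim: s => [|phi s [C C0 IH]].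
  exists 0 => // N v B _; rewrite mul0r big1// => i _.
  by rewrite /dual_seminorm big_nil.
have [D D0 phiD] := dual_bounded phi.
exists (D + C) => [|N v B vB]; first exact: addr_ge0.
under eq_bigr do rewrite /dual_seminorm big_cons.
rewrite big_split/= mulrDl lerD ?IH//.
(* When phi (v i) = 0 this coefficient is 0, as 0^-1 = 0. *)
pose a i : R[i] := (rnorm (phi (v i) : R[i]))%:C / (phi (v i) : R[i]).
have a1 i : rnorm (a i) <= 1.
  rewrite rnormM rnormV rnormC ger0_norm ?rnorm_ge0//.
  have [->|p0] := eqVneq (rnorm (phi (v i) : R[i])) 0; first by rewrite mul0r.
  by rewrite divff.
apply: le_trans (ler_wpM2l D0 (vB a a1)).
apply: le_trans (phiD _); rewrite linear_sum/=.
have -> : \sum_i phi (a i *: v i) =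
    (\sum_i rnorm (phi (v i) : R[i]))%:C :> R[i].
  rewrite rmorph_sum; apply: eq_bigr => i _; rewrite linearZ /= /a.
  have [p0|p0] := eqVneq (phi (v i) : R[i]) 0.
    by rewrite /GRing.scale/= p0 mulr0 rnorm0.
  by rewrite /GRing.scale/= divfK.
by rewrite rnormC ler_norm.
Qed.

End Duality.

Lemma exists_le_average (R : realFieldType) N (t : 'I_N -> R) (B : R) :
  (0 < N)%N -> \sum_i t i <= B -> exists i, t i <= B / N%:R.
Proof.
move=> N0 tB; apply: contrapT => nt.
have : \sum_(i < N) B / N%:R < \sum_i t i.
  apply: ltr_sum; first by apply/hasP; exists (Ordinal N0); rewrite ?mem_index_enum.
  by move=> i _; rewrite ltNge; apply/negP => ti; apply: nt; exists i.
rewrite sumr_const card_ord -[X in X < _]mulr_natr divfK ?pnatr_eq0 -?lt0n//.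
by move/lt_le_trans => /(_ _ tB); rewrite ltxx.
Qed.

Lemma exists_expr_lt (R : realType) (r e : R) : 0 <= r < 1 -> 0 < e ->
  exists n, r ^+ n < e.
Proof.
move=> /andP[r0 r1] e0; have nr1 : `|r| < 1 by rewrite ger0_norm.
have [N _ /(_ N (leqnn N)) /=] := cvgr0_norm_lt _ (cvg_expr nr1) _ e0.
by exists N; rewrite -[ltLHS]ger0_norm// exprn_ge0.
Qed.

(** * Disjoint neighbourhoods near an accumulation point *)

Section DisjointNeighbourhoods.

(** Pick a point of [E] in [V] other than [w0], separate the two, and go on inside
    the part of [V] separated from the chosen point. *)
Lemma limit_point_disjoint_nbhs (T : topologicalType) (E : set T) (w0 : T) :
  hausdorff_space T -> limit_point E w0 ->
  forall N (V : set T), open V -> V w0 ->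
  exists (w : nat -> T) (U : nat -> set T),
    (forall i, (i < N)%N -> [/\ E (w i), open (U i), U i (w i) & U i `<=` V]) /\
    (forall i j t, (i < N)%N -> (j < N)%N -> U i t -> U j t -> i = j).
Proof.
rewrite open_hausdorff => T2 w0E; elim=> [|N IH] V oV Vw0.
  by exists (fun=> w0), (fun=> setT); split.
have [w [ww0 Ew Vw]] := w0E V (open_nbhs_nbhs (conj oV Vw0)).
have [[A B] /= [/set_mem Aw /set_mem Bw0] [oA oB /eqP AB]] := T2 _ _ ww0.
have [x [U [xU Udisj]]] := IH (V `&` B) (openI oV oB) (conj Vw0 Bw0).
have AU t i : (i < N)%N -> A t -> U i t -> False.
  move=> iN At Ut; have [_ _ _ /(_ _ Ut)[_ Bt]] := xU _ iN.
  by have : (A `&` B) t by []; rewrite AB.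
exists (fun i => if i is i'.+1 then x i' else w).
exists (fun i => if i is i'.+1 then U i' else V `&` A); split.
  case=> [_|i /xU[? ? ? UV]]; first by split=> //; exact: openI.
  by split=> //; apply: subset_trans UV (@subIsetl _ _ _).
move=> [|i] [|j] t //=.
- by move=> _ jN [_ At] /(AU _ _ jN At).
- by move=> iN _ Ut [_ At]; have := AU _ _ iN At Ut.
- by move=> iN jN ? ?; congr S; exact: (Udisj i j t).
Qed.

End DisjointNeighbourhoods.

(** * Peak functions with values near the segment [0, 1] *)

Section FunctionAlgebras.
Variables (R : realType) (T : topologicalType).

Lemma rnorm_le_sup_norm_on (V : normedModType R[i]) (D : set T) (f : bcfun T V)
    t : D t -> rnorm (f t) <= sup_norm_on D f.
Proof.
move=> Dt; apply: sup_upper_bound; last by exists t.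
split; first by exists (rnorm (f t)), t.
have /bcfunP[_ [M Mf]] := bcfun_valP f.
by exists M => _ [s _ <-]; rewrite -lecR RRe_real ?normr_real.
Qed.

Lemma rnorm_bcfun (V : normedModType R[i]) (f : bcfun T V) :
  rnorm f = sup_norm_on setT f.
Proof. by rewrite /rnorm bcfun_normE. Qed.

Lemma rnorm_bcfun_ge (V : normedModType R[i]) (f : bcfun T V) t :
  rnorm (f t) <= rnorm f.
Proof. by rewrite rnorm_bcfun; apply: rnorm_le_sup_norm_on. Qed.

Lemma rnorm_bcfun_le (V : normedModType R[i]) (f : bcfun T V) (M : R) :
  0 <= M -> (forall t, rnorm (f t) <= M) -> rnorm f <= M.
Proof.
move=> M0 Mf; rewrite rnorm_bcfun /sup_norm_on.
have [->|/set0P ne] :=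
  eqVneq [set complex.Re `|f t| | t in setT] (set0 : set R).
  by rewrite sup0.
by apply: ge_sup => // _ [s _ <-]; exact: Mf.
Qed.

Variable A : set (bcfun T R[i]^o).
Hypothesis Aalg : function_algebra A.

(** The factor [k t] keeps the constant term at 0, since [A] may lack constants. *)
Lemma function_algebra_poly (k : bcfun T R[i]^o) (p : {poly R[i]}) : A k ->
  exists2 h, A h & forall t, h t = (k t : R[i]) * p.[k t].
Proof.
have [[A0 Alin] AM _ _] := Aalg => Ak.
elim/poly_ind: p => [|p c [h Ah hE]].
  by exists 0 => [|t]; [exact/set_mem|rewrite horner0 mulr0].
exists (c *: k + bcfun_scale h k).
  by apply/set_mem; apply: Alin; apply/mem_set => //; exact: AM.
move=> t; rewrite hornerMXaddC.
transitivity (c * (k t : R[i]) + (h t : R[i]) * k t) => //.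
by rewrite hE; ring.
Qed.

(** A high power of a peak function is small off [U]; composing it with
    [z * (flat_poly L).[z]], which does not increase moduli on the unit disc,
    then flattens its range. *)
Lemma strong_boundary_flat_peak (w : T) (U : set T) (e d : R) :
  strong_boundary A w -> open U -> U w -> 0 < e -> 0 < d ->
  exists h, [/\ A h, h w = 1, forall t, rnorm (h t) <= 1,
    forall t, rnorm (1 - 2 * (h t : R[i])) <= 1 + e &
    forall t, ~ U t -> rnorm (h t) <= d].
Proof.
move=> Aw oU Uw e0 d0; have [k [Ak kw k1 kU]] := Aw U oU Uw.
have kt t : rnorm (k t : R[i]) <= 1.
  by apply: le_trans (rnorm_bcfun_ge k t) _; rewrite /rnorm k1.
pose r := Num.max 0 (sup_norm_on (~` U) k).
have r01 : 0 <= r < 1 by rewrite /r le_max lexx gt_max ltr01.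
have [M Md] := exists_expr_lt r01 d0.
have [kM AkM kME] := function_algebra_poly 'X^M Ak.
have kMt t : rnorm (kM t : R[i]) <= 1.
  by rewrite kME hornerXn -exprS rnormX exprn_ile1// rnorm_ge0.
pose L := (Num.bound (12 / e)).+1.
have Le : 12 / L%:R <= e.
  rewrite ler_pdivrMr ?ltr0n// mulrC -ler_pdivrMr//.
  by apply: le_trans (ltW (archi_boundP _)) _; rewrite ?ler_nat// divr_ge0// ltW.
have [h Ah hE] := function_algebra_poly (flat_poly R L) AkM.
exists h; split => //.
- by rewrite hE kME hornerXn kw -exprS expr1n flat_poly1// mulr1.
- move=> t; rewrite hE rnormM -[leRHS]mulr1 ler_pM ?rnorm_ge0//.
  exact: flat_poly_le1.
- move=> t; rewrite hE; apply: le_trans (flat_poly_flat _ (kMt t)) _ => //.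
  by rewrite lerD2l.
- move=> t nUt; apply: le_trans (ltW Md).
  have kr : rnorm (k t : R[i]) <= r.
    by rewrite /r le_max; apply/orP; right; exact: (rnorm_le_sup_norm_on k nUt).
  have : rnorm (kM t : R[i]) <= r ^+ M.
    rewrite kME hornerXn rnormM rnormX -[leRHS]mul1r.
    rewrite ler_pM ?rnorm_ge0 ?exprn_ge0 ?rnorm_ge0//.
    by rewrite lerXn2r// nnegrE ?rnorm_ge0//; case/andP: r01.
  apply: le_trans; rewrite hE rnormM -[leRHS]mulr1 ler_pM ?rnorm_ge0//.
  exact: flat_poly_le1.
Qed.

End FunctionAlgebras.

(** * Reflecting a vector-valued function at a bump *)

Section Reflection.
Variables (K : comNzRingType) (V : lmodType K).
Implicit Types (c : K) (f v : V).

Lemma reflection_subE c f v :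
  c *: (f - 2 *: v) - f = (c - 1) *: f + (- 2 * c) *: v.
Proof.
by rewrite scalerBr scalerA addrAC scalerBl scale1r mulNr [2 * c]mulrC scaleNr.
Qed.

Lemma sub_reflectionE c f : f - c *: (f - 2 *: f) = (1 + c) *: f.
Proof.
rewrite -[in X in c *: X](scale1r f) scalerA -scalerBl scalerA.
by rewrite -{1}[f]scale1r -scalerBl; congr (_ *: _); ring.
Qed.

End Reflection.

Local Notation "f \at t" := ((normed_subspace_val f : bcfun _ _) t)
  (at level 10).

Section Subspaces.
Variables (R : realType) (T : topologicalType) (X : normedModType R[i]).
Variable AX : submodClosed (bcfun T X).
Local Notation Z := (normed_subspace AX).

Lemma normed_subspace_rnorm_le (g : Z) (M : R) :
  0 <= M -> (forall t, rnorm (g \at t) <= M) -> rnorm g <= M.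
Proof. exact: rnorm_bcfun_le. Qed.

Lemma normed_subspace_rnorm_ge (g : Z) t : rnorm (g \at t) <= rnorm g.
Proof. exact: (rnorm_bcfun_ge (normed_subspace_val g)). Qed.

Lemma normed_subspace_sumE I (r : seq I) (F : I -> Z) t :
  (\sum_(i <- r) F i) \at t = \sum_(i <- r) (F i) \at t.
Proof. by apply: (big_morph (fun g : Z => g \at t)). Qed.

Lemma normed_subspace_subZE (g h : Z) (a : R[i]) t :
  (g - a *: h) \at t = g \at t - a *: h \at t.
Proof. by []. Qed.

Lemma normed_subspace_scaleE (g : Z) (a : R[i]) t : (a *: g) \at t = a *: g \at t.
Proof. by []. Qed.

(** Relatively weakly open sets are replaced by the seminorm balls they contain. *)
Lemma super_delta_point_of_seminorm (f : Z) : `|f| = 1 ->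
  (forall (s : seq (topological_dual Z)) (d e : R), 0 < d -> 0 < e ->
    exists g : Z, [/\ rnorm g <= 1, dual_seminorm s (g - f) < d &
      2 - e < rnorm (f - g)]) ->
  super_delta_point f.
Proof.
move=> f1 Hf; split=> // W [U oU ->] [_ Uf] e e0.
have eE : (complex.Re e)%:C = e by rewrite RRe_real// gtr0_real.
have [s [d [d0 sU]]] := weakly_open_seminorm oU Uf.
have [|g [g1 gs gf]] := Hf s d (complex.Re e) d0; first by rewrite -ltcR eE.
exists g; last first.
  by rewrite -rnormE -eE -(rmorph_nat (real_complex R)) -rmorphB ltcR.
split; last exact: sU.
by rewrite /closed_unit_ball /= -rnormE -[leRHS]/((1 : R)%:C) lecR.
Qed.

End Subspaces.

(** The [v i] are products [h_i f] of [f] with flat peak functions at points with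
    disjoint neighbourhoods.  At any point all but at most one of the [h_i] are
    bounded by [1 / N], so the moduli of the [h_i] add up to at most 2. *)
Lemma reflected_bumps (R : realType) (X : normedModType R[i])
    (T : topologicalType) (AX : submodClosed (bcfun T X)) :
  hausdorff_space T -> vector_valued_function_algebra AX ->
  forall (f : normed_subspace AX) w0, rnorm f <= 1 ->
  limit_point (strong_boundary (base_algebra AX)) w0 ->
  rnorm (f \at w0) = 1 ->
  forall (N : nat) (tau : R), 0 < tau < 1 ->
  exists v : 'I_N -> normed_subspace AX,
    [/\ forall i, rnorm (f - 2 *: v i) <= 1 + tau,
        forall i, exists2 t, v i \at t = f \at t & 1 - tau < rnorm (f \at t)
      & forall a : 'I_N -> R[i], (forall i, rnorm (a i) <= 1) ->
          rnorm (\sum_i a i *: v i) <= 2].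
Proof.
move=> T2 [_ Aalg _ AXM] f w0 f1 w0A fw0 N tau /andP[tau0 tau1].
have ft t : rnorm (f \at t) <= 1.
  by apply: le_trans (normed_subspace_rnorm_ge _ _) _.
pose V := [set t : T | 1 - tau < rnorm (f \at t)].
have oV : open V.
  rewrite openE => t Vt.
  have /bcfunP[cf _] := bcfun_valP (normed_subspace_val f).
  have d0 : 0 < (rnorm (f \at t) - (1 - tau))%:C by rewrite ltcR subr_gt0.
  have /cvgr_dist_lt cft := cf t; move: (cft _ d0).
  apply: filterS => u.
  rewrite -rnormE ltcR /V/= => tu.
  have := rnormD (f \at t - f \at u) (f \at u); rewrite subrK; lra.
have Vw0 : V w0 by rewrite /V/= fw0 ltrBlDr ltrDl.
have [w [U [wU Udisj]]] := limit_point_disjoint_nbhs T2 w0A N oV Vw0.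
have bump (i : 'I_N) : exists hv : bcfun T R[i]^o * normed_subspace AX,
    [/\ (forall t, hv.2 \at t = (hv.1 t : R[i]) *: f \at t),
        hv.1 (w i) = 1, forall t, rnorm (hv.1 t) <= 1,
        forall t, rnorm (1 - 2 * (hv.1 t : R[i])) <= 1 + tau &
        forall t, ~ U i t -> rnorm (hv.1 t) <= N%:R^-1].
  have [Aw oU Uw _] := wU i (ltn_ord i).
  have N0 : 0 < N%:R^-1 :> R.
    by rewrite invr_gt0 ltr0n; exact: leq_ltn_trans (ltn_ord i).
  have [h [Ah hw h1 h2 hU]] := strong_boundary_flat_peak Aalg Aw oU Uw tau0 N0.
  by exists (h, NormedSubspace (AXM _ _ Ah (normed_subspace_valP f))).
have {bump}[hv hvP] := choice bump.
exists (fun i => (hv i).2); split.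
- move=> i; have [vE _ _ h2 _] := hvP i.
  apply: normed_subspace_rnorm_le => [|t]; first by rewrite addr_ge0// ltW.
  have -> : (f - 2 *: (hv i).2) \at t = (1 - 2 * ((hv i).1 t : R[i])) *: f \at t.
    by rewrite normed_subspace_subZE vE scalerBl scale1r scalerA.
  by rewrite rnormZ -[leRHS]mulr1 ler_pM ?rnorm_ge0.
- move=> i; have [vE hw _ _ _] := hvP i; have [_ _ Uw UV] := wU i (ltn_ord i).
  by exists (w i); [rewrite vE hw scale1r|exact: UV].
- move=> a a1; apply: normed_subspace_rnorm_le => // t.
  rewrite normed_subspace_sumE.
  apply: le_trans (rnorm_sum _ _) _.
  apply: (@le_trans _ _ (\sum_i rnorm ((hv i).1 t))).
    apply: ler_sum => i _; have [vE _ _ _ _] := hvP i.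
    have -> : (a i *: (hv i).2) \at t = (a i * ((hv i).1 t : R[i])) *: f \at t.
      by rewrite normed_subspace_scaleE vE scalerA.
    rewrite rnormZ rnormM -[leRHS]mulr1 ler_pM ?rnorm_ge0 ?mulr_ge0 ?rnorm_ge0//.
    by rewrite -[leRHS]mul1r ler_pM ?rnorm_ge0.
  have NV : \sum_(i < N) (N%:R^-1 : R) <= 1.
    rewrite sumr_const card_ord -[leLHS]mulr_natl.
    have [->|N0] := eqVneq N 0%N; first by rewrite mul0r.
    by rewrite mulfV// pnatr_eq0.
  have [[i Ut]|nU] := pselect (exists i : 'I_N, U i t).
    have [_ _ h1 _ _] := hvP i.
    rewrite (bigD1 i)//= lerD//; apply: le_trans NV.
    rewrite [leRHS](bigD1 i)//= -[leLHS]add0r lerD ?invr_ge0//.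
    apply: ler_sum => j ji; have [_ _ _ _ ->] := hvP j => // Ujt.
    by move/eqP: ji; apply; apply/val_inj; exact: (Udisj j i t).
  apply: (@le_trans _ _ 1); last by rewrite ler1n.
  apply: le_trans NV; apply: ler_sum => i _; have [_ _ _ _ ->] := hvP i => // Uit.
  by apply: nU; exists i.
Qed.

Theorem proposition2p13 (R : realType) (X : completeNormedModType R[i])
    (T : topologicalType) (AX : submodClosed (bcfun T X)) :
  hausdorff_space T -> regular_space T ->
  vector_valued_function_algebra AX ->
  forall f : normed_subspace AX, `|f| = 1 ->
  (exists2 w0, limit_point (strong_boundary (base_algebra AX)) w0 &
    `|(normed_subspace_val f : bcfun T X) w0| = 1) ->
  super_delta_point f.
Proof.
move=> T2 _ AXP f f1 [w0 w0A fw0].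
apply: super_delta_point_of_seminorm => // s d e d0 e0.
have f1' : rnorm f = 1 by rewrite /rnorm f1.
have fw0' : rnorm (f \at w0) = 1 by rewrite /rnorm fw0.
have [C C0 sC] := dual_seminorm_unconditional s.
pose Pf := dual_seminorm s f.
have Pf0 : 0 <= Pf := dual_seminorm_ge0 s f.
have [tau [/andP[tau0 tau1] tauP taue]] : exists tau : R,
    [/\ 0 < tau < 1, tau * Pf <= d / 2 & 3 * tau <= e].
  pose M := 3 / e + Pf / (d / 2) + 2.
  have M0 : 0 < M by rewrite ltr_wpDl// addr_ge0// divr_ge0// ?divr_ge0 ?ltW.
  exists M^-1; split.
  - rewrite invr_gt0 M0/= invf_lt1// /M ltr_wpDl// ?ltr1n//.
    by rewrite addr_ge0// divr_ge0// ?divr_ge0 ?ltW.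
  - rewrite mulrC ler_pdivrMr// mulrC -ler_pdivrMr ?divr_gt0// /M.
    have : 0 <= 3 / e by rewrite divr_ge0// ltW.
    lra.
  - rewrite ler_pdivrMr// mulrC -ler_pdivrMr// /M.
    have : 0 <= Pf / (d / 2) by rewrite divr_ge0// divr_ge0// ltW.
    lra.
(* By averaging, some bump has seminorm at most 2 C / N; twice this has to stay
   below d / 2, the other half being spent on tau * Pf. *)
pose N := (Num.bound (8 * C / d)).+1.
have NC : 2 * (C * 2 / N%:R) < d / 2.
  rewrite mulrA ltr_pdivrMr ?ltr0n// mulrAC ltr_pdivlMr// mulrC.
  rewrite -ltr_pdivrMl//.
  have : 8 * C / d < N%:R.
    apply: lt_le_trans (archi_boundP _) _; last by rewrite ler_nat.
    by rewrite divr_ge0 ?mulr_ge0// ltW.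
  lra.
have tau01 : 0 < tau < 1 by rewrite tau0.
have [|v [v1 vt va]] := reflected_bumps T2 AXP _ w0A fw0' N tau01.
  by rewrite f1'.
have [i vi] := exists_le_average (isT : (0 < N)%N) (sC _ _ _ va).
pose c := 1 - tau.
have c0 : 0 <= c by rewrite subr_ge0 ltW.
have [t vft ftau] := vt i.
exists (c%:C *: (f - 2 *: v i)); split.
- rewrite rnormZ rnormC ger0_norm//.
  have := ler_wpM2l c0 (v1 i); rewrite /c; nra.
- have -> : c%:C *: (f - 2 *: v i) - f = (- tau)%:C *: f + (- 2 * c)%:C *: v i.
    have -> : (- tau)%:C = c%:C - 1.
      by rewrite -(rmorph1 (real_complex R)) -rmorphB /c addrC addKr.
    by rewrite rmorphM rmorphN rmorph_nat reflection_subE.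
  apply: le_lt_trans (dual_seminormD _ _ _) _.
  rewrite !dual_seminormZ !rnormC normrN gtr0_norm// normrM normrN normr_nat.
  rewrite ger0_norm// -/Pf.
  have := dual_seminorm_ge0 s (v i); rewrite /c; nra.
- apply: lt_le_trans (normed_subspace_rnorm_ge _ t).
  have -> : (f - c%:C *: (f - 2 *: v i)) \at t = (1 + c)%:C *: f \at t.
    rewrite normed_subspace_subZE normed_subspace_subZE vft.
    rewrite (rmorphD (real_complex R) 1 c) rmorph1.
    exact: sub_reflectionE.
  have c1 : 0 <= 1 + c by lra.
  rewrite rnormZ rnormC ger0_norm//.
  rewrite /c; nra.
Qed.
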